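(* Let $\alpha>-1$, $\beta>-1$ be real and let $P_n^{(-1)}(x)$, $n=0,1,2,\dots$, be the monic little $-1$ Jacobi polynomials with parameters $(\alpha,\beta)$. Then for each $n$ there is a normalization constant $\kappa_n\neq0$ such that, if $n$ is even, $$P_n^{(-1)}(x)=\kappa_n\left[{}_2F_1\left(-\tfrac n2,\tfrac{n+\alpha+\beta+2}{2};\tfrac{\alpha+1}{2};x^2\right)+\frac{nx}{\alpha+1}\,{}_2F_1\left(1-\tfrac n2,\tfrac{n+\alpha+\beta+2}{2};\tfrac{\alpha+3}{2};x^2\right)\right],$$ and, if $n$ is odd, $$P_n^{(-1)}(x)=\kappa_n\left[{}_2F_1\left(\tfrac{1-n}{2},\tfrac{n+\alpha+\beta+1}{2};\tfrac{\alpha+1}{2};x^2\right)-\frac{(\alpha+\beta+n+1)x}{\alpha+1}\,{}_2F_1\left(\tfrac{1-n}{2},\tfrac{n+\alpha+\beta+3}{2};\tfrac{\alpha+3}{2};x^2\right)\right].$$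
   Context: The little $-1$ Jacobi polynomials with parameters $(\alpha,\beta)$ are the monic polynomials defined by $P_{-1}=0$, $P_0=1$, $P_{n+1}(x)+b_nP_n(x)+u_nP_{n-1}(x)=xP_n(x)$ with $$u_n=\frac{(n+(1-\theta_n)\alpha)(n+\beta+\theta_n\alpha)}{(2n+\alpha+\beta)^2},\quad b_n=(-1)^n\frac{(2n+1)\alpha+\alpha\beta+\alpha^2+(-1)^n\beta}{(2n+\alpha+\beta)(2n+2+\alpha+\beta)},\quad \theta_n=\frac{1+(-1)^n}{2}$$ (with $b_0=\frac{\alpha+1}{\alpha+\beta+2}$, which is the value of the formula at $n=0$ when $\alpha+\beta\ne0$). Equivalently, they are the monic polynomials orthogonal on $[-1,1]$ with respect to the weight $|x|^{\alpha}(1-x^2)^{(\beta-1)/2}(1+x)$. Here ${}_2F_1(A,B;C;z)=\sum_{k\ge0}\frac{(A)_k(B)_k}{(C)_k\,k!}z^k$ is the Gauss hypergeometric function with $(x)_k=x(x+1)\cdots(x+k-1)$; all the series above terminate, except that for $n=0$ the second term is understood to be $0$ because of the factor $n$. *)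

(* Defs.v *)
From mathcomp Require Import all_boot all_order all_algebra.
From mathcomp Require Import all_classical all_reals all_analysis.

Set Implicit Arguments.
Unset Strict Implicit.
Unset Printing Implicit Defensive.

Import Order.TTheory GRing.Theory Num.Theory.
Import numFieldNormedType.Exports.
Local Open Scope classical_set_scope.
Local Open Scope ring_scope.

(* (x)_k = x (x + 1) ... (x + k - 1) *)
Definition pochhammer (R : realType) (x : R) (k : nat) : R :=
  \prod_(i < k) (x + i%:R).

(* Sum of the Gauss series; as with every library [lim], the value is
   unspecified when the series diverges. *)
Definition hyp2F1 (R : realType) (A B C z : R) : R :=
  limn (series (fun k : nat =>
    pochhammer A k * pochhammer B k / (pochhammer C k * k`!%:R) * z ^+ k)).

Section LittleMinusOneJacobi.
Variables (R : realType) (alpha beta : R).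

Definition lm1j_theta (n : nat) : R := (1 + (-1) ^+ n) / 2.

(* At n = 0 this is only ever multiplied by P_{-1} = 0. *)
Definition lm1j_u (n : nat) : R :=
  (n%:R + (1 - lm1j_theta n) * alpha) * (n%:R + beta + lm1j_theta n * alpha)
    / (2 * n%:R + alpha + beta) ^+ 2.

(* The general formula is 0/0 at n = 0 when alpha + beta = 0, hence the
   separate (simplified) value there. *)
Definition lm1j_b (n : nat) : R :=
  if n == 0%N then (alpha + 1) / (alpha + beta + 2)
  else (-1) ^+ n *
    (((2 * n%:R + 1) * alpha + alpha * beta + alpha ^+ 2 + (-1) ^+ n * beta)
      / ((2 * n%:R + alpha + beta) * (2 * n%:R + 2 + alpha + beta))).

(* The pair (P_{n-1}, P_n), starting from P_{-1} = 0 and P_0 = 1. *)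
Fixpoint lm1j_pair (n : nat) : {poly R} * {poly R} :=
  if n is m.+1 then
    let: (Pprev, P) := lm1j_pair m in
    (P, 'X * P - lm1j_b m *: P - lm1j_u m *: Pprev)
  else (0, 1).

Definition little_m1_Jacobi (n : nat) : {poly R} := (lm1j_pair n).2.

Lemma little_m1_Jacobi0 : little_m1_Jacobi 0 = 1.
Proof. by []. Qed.

Lemma little_m1_Jacobi_rec (n : nat) :
  little_m1_Jacobi n.+1 + lm1j_b n *: little_m1_Jacobi n
    + lm1j_u n *: (if n is m.+1 then little_m1_Jacobi m else 0)
  = 'X * little_m1_Jacobi n.
Proof.
have -> : (if n is m.+1 then little_m1_Jacobi m else 0) = (lm1j_pair n).1.
  by case: n => //= n; rewrite /little_m1_Jacobi; case: (lm1j_pair n).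
rewrite /little_m1_Jacobi /=; case: (lm1j_pair n) => p q /=.
by rewrite -addrA [_ *: q + _]addrC addrA subrK subrK.
Qed.

End LittleMinusOneJacobi.

(* Main.v *)
(** Splitting [P_n] into even and odd powers of [x], its coefficients are products of
    shifted factorials. After clearing the normalizations, the three-term recurrence
    for these explicit coefficients becomes, power by power, an identity of rational
    functions in [alpha], [beta], [m], [k]: all the factorials occurring in it are
    rational multiples of [(-m-1)_k], [(m+s+1)_k], [(a)_k] and [k!], where
    [a = (alpha+1)/2] and [s = (alpha+beta)/2]. Since [a > 0] and [s + 1 > 0], no
    denominator vanishes. *)

Require Import Defs.
From mathcomp Require Import all_boot all_order all_algebra.
From mathcomp Require Import all_classical all_reals all_analysis.
From mathcomp Require Import ring lra.

Set Implicit Arguments.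
Unset Strict Implicit.
Unset Printing Implicit Defensive.

Import Order.TTheory GRing.Theory Num.Theory.
Import numFieldNormedType.Exports.
Local Open Scope ring_scope.

(** * Shifted factorials *)

Section Pochhammer.
Variable R : realType.
Implicit Types (x : R) (k N : nat).

Lemma pochhammer0 x : pochhammer x 0 = 1.
Proof. by rewrite /pochhammer big_ord0. Qed.

Lemma pochhammerSr x k : pochhammer x k.+1 = pochhammer x k * (x + k%:R).
Proof. by rewrite /pochhammer big_ord_recr. Qed.

Lemma pochhammerSl x k : pochhammer x k.+1 = x * pochhammer (x + 1) k.
Proof.
rewrite /pochhammer big_ord_recl addr0; congr (_ * _).
by apply: eq_bigr => i _; rewrite -addrA nat1r.
Qed.

(** Trades a shift of the base for a rational factor; this brings the factorials of the recurrence
    to common bases. *)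
Lemma pochhammerD1 x k : x != 0 ->
  pochhammer (x + 1) k = pochhammer x k * (x + k%:R) / x.
Proof. by move=> x0; rewrite -pochhammerSr pochhammerSl mulrAC divff ?mul1r. Qed.

Lemma pochhammer_gt0 x k : 0 < x -> 0 < pochhammer x k.
Proof. by move=> x0; apply: prodr_gt0 => i _; rewrite ltr_wpDr. Qed.

Lemma pochhammerN_eq0 N k : (N < k)%N -> pochhammer (- N%:R : R) k = 0.
Proof.
by move=> Nk; rewrite /pochhammer (bigD1 (Ordinal Nk)) //= addNr mul0r.
Qed.

End Pochhammer.

(** * Terminating Gauss series as finite sums *)

Section GaussSeries.
Variable R : realType.
Implicit Types (A B C z : R) (k N M : nat).

Definition gauss_coef A B C k : R :=
  pochhammer A k * pochhammer B k / (pochhammer C k * k`!%:R).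

(** The partial sums are constant from [M] on, so the limit is attained. Leaving [M] free lets
    series of different lengths share one range. *)
Lemma hyp2F1_terminating N M B C z : (N < M)%N ->
  hyp2F1 (- N%:R) B C z = \sum_(k < M) gauss_coef (- N%:R) B C k * z ^+ k.
Proof.
move=> NM; apply: (cvg_lim (@Rhausdorff R)); apply: cvg_near_cst.
exists M => //= n /= Mn; apply/eqP.
rewrite seriesEnat /= (big_cat_nat _ Mn) //= big_mkord [X in _ + X]big_nat_cond.
rewrite [X in _ + X]big1 ?addr0 // => k /andP[/andP[Mk _] _].
by rewrite pochhammerN_eq0 ?(leq_trans NM) // !mul0r.
Qed.

End GaussSeries.

Lemma horner_even_odd (R : comNzRingType) (p : {poly R}) (M : nat) (x : R) :
  (size p <= M.*2)%N ->
  p.[x] = \sum_(k < M) p`_k.*2 * (x ^+ 2) ^+ k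
        + x * \sum_(k < M) p`_k.*2.+1 * (x ^+ 2) ^+ k.
Proof.
move=> sp; rewrite (horner_coef_wide _ sp).
elim: M {sp} => [|M IH]; first by rewrite !big_ord0 mulr0 addr0.
rewrite doubleS !big_ord_recr /= IH -!exprM !mul2n (exprS x M.*2).
move: (x ^+ M.*2) => y; ring.
Qed.

(** * Coefficients and degrees from the three-term recurrence *)

Section LittleMinusOneJacobi.
Context {R : realType} (alpha beta : R).

Local Notation P := (little_m1_Jacobi alpha beta).
Local Notation a := ((alpha + 1) / 2).
Local Notation s := ((alpha + beta) / 2).
Local Notation b := (lm1j_b alpha beta).
Local Notation u := (lm1j_u alpha beta).

Lemma little_m1_Jacobi1 : P 1 = 'X - (b 0)%:P.
Proof.
have := little_m1_Jacobi_rec alpha beta 0.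
rewrite little_m1_Jacobi0 /= scaler0 addr0 mulr1 alg_polyC => <-.
by rewrite addrK.
Qed.

Lemma little_m1_JacobiSS n :
  P n.+2 = 'X * P n.+1 - b n.+1 *: P n.+1 - u n.+1 *: P n.
Proof. by rewrite -little_m1_Jacobi_rec addrAC addrK addrK. Qed.

Lemma coef_little_m1_JacobiSS n j :
  (P n.+2)`_j = (if j is i.+1 then (P n.+1)`_i else 0)
                - b n.+1 * (P n.+1)`_j - u n.+1 * (P n)`_j.
Proof.
by rewrite little_m1_JacobiSS !coefB !coefZ coefXM; case: j.
Qed.

Lemma size_little_m1_Jacobi n : (size (P n) <= n.+1)%N.
Proof.
(* The recurrence reaches back two degrees, so the induction carries a consecutive pair. *)
have [] // : (size (P n) <= n.+1)%N /\ (size (P n.+1) <= n.+2)%N.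
elim: n => [|n [IH0 IH1]].
  by rewrite little_m1_Jacobi0 size_poly1 little_m1_Jacobi1 size_XsubC.
split=> //; apply/leq_sizeP => -[//|j] nj; rewrite coef_little_m1_JacobiSS.
move: IH0 IH1 => /leq_sizeP-> ; last exact: leq_trans (ltnW nj).
move=> /leq_sizeP IH1; rewrite !IH1 ?mulr0 ?subr0 //; exact: ltnW.
Qed.

(* Coefficient of [x ^+ j] in the bracket attached to the degree [m.*2], resp.
   [m.*2.+1]; the prefactors of the second series are absorbed into the shifted
   factorials, so that the formulas also make sense for [m = 0]. *)
Definition even_bracket (m j : nat) : R :=
  let k := j./2 in
  if odd j then
    - (pochhammer (- m%:R) k.+1 * pochhammer (m%:R + s + 1) k
       / (pochhammer a k.+1 * k`!%:R))
  else gauss_coef (- m%:R) (m%:R + s + 1) a k.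

Definition odd_bracket (m j : nat) : R :=
  let k := j./2 in
  if odd j then
    - (pochhammer (- m%:R) k * pochhammer (m%:R + s + 1) k.+1
       / (pochhammer a k.+1 * k`!%:R))
  else gauss_coef (- m%:R) (m%:R + s + 1) a k.

(** For [a, s + 1 > 0] the product telescopes to [(-1)^m (a)_m / (m+s+1)_m], the inverse of the top
    coefficient of the bracket, as monicity requires. *)
Definition even_norm (m : nat) : R :=
  \prod_(i < m) - ((a + i%:R) * (i%:R + s + 1)
                   / ((2 * i%:R + s + 1) * (2 * i%:R + s + 2))).

Definition odd_norm (m : nat) : R :=
  - (even_norm m * (a + m%:R) / (2 * m%:R + s + 1)).

Hypotheses (halpha : -1 < alpha) (hbeta : -1 < beta).

Let a_gt0 : 0 < a. Proof. by move: halpha; lra. Qed.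
Let s_gtN1 : 0 < s + 1. Proof. by move: halpha hbeta; lra. Qed.

(** * Recurrence coefficients by parity, and the bracket recurrence *)

Lemma lm1j_u_odd m :
  u m.*2.+1 = (2 * m%:R + 1 + alpha) * (2 * m%:R + 1 + beta)
              / (4 * m%:R + 2 + alpha + beta) ^+ 2.
Proof.
rewrite /lm1j_u /lm1j_theta -signr_odd /= odd_double expr1.
rewrite -(natr1 m.*2) -mul2n natrM.
by congr (_ * _ / _ ^+ 2); ring.
Qed.

Lemma lm1j_u_even m :
  u m.+1.*2 = (2 * m%:R + 2) * (2 * m%:R + 2 + alpha + beta)
              / (4 * m%:R + 4 + alpha + beta) ^+ 2.
Proof.
rewrite /lm1j_u /lm1j_theta -signr_odd /= odd_double expr0 -mul2n natrM -(natr1 m).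
by congr (_ / _ ^+ 2); field.
Qed.

Lemma lm1j_b_odd m :
  b m.*2.+1 = - (((4 * m%:R + 3) * alpha + alpha * beta + alpha ^+ 2 - beta)
    / ((4 * m%:R + 2 + alpha + beta) * (4 * m%:R + 4 + alpha + beta))).
Proof.
rewrite /lm1j_b -signr_odd /= odd_double expr1 mulN1r -(natr1 m.*2) -mul2n natrM.
by congr (- (_ / (_ * _))); ring.
Qed.

(** The index [m.+1] keeps away from the separate value [b 0], which enters only in the base case of
    the induction. *)
Lemma lm1j_b_even m :
  b m.+1.*2 = ((4 * m%:R + 5) * alpha + alpha * beta + alpha ^+ 2 + beta)
    / ((4 * m%:R + 4 + alpha + beta) * (4 * m%:R + 6 + alpha + beta)).
Proof.
rewrite /lm1j_b -signr_odd /= odd_double expr0 mul1r -mul2n natrM -(natr1 m).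
by congr (_ / (_ * _)); ring.
Qed.

(* Three-term recurrence for the brackets, divided by [odd_norm m] and by
   [even_norm m.+1] respectively. *)
Lemma bracket_recurrence m j :
  (m%:R + s + 1) / (2 * m%:R + s + 2) * even_bracket m.+1 j
  = (if j is i.+1 then odd_bracket m i else 0) - b m.*2.+1 * odd_bracket m j
    + u m.*2.+1 * ((2 * m%:R + s + 1) / (a + m%:R)) * even_bracket m j
  /\
  - ((a + m.+1%:R) / (2 * m%:R + s + 3)) * odd_bracket m.+1 j
  = (if j is i.+1 then even_bracket m.+1 i else 0)
    - b m.+1.*2 * even_bracket m.+1 j
    - u m.+1.*2 * ((2 * m%:R + s + 2) / (m%:R + s + 1)) * odd_bracket m j.
Proof.
have ha := halpha; have hb := hbeta.
(* [e1] and [e2] present the parameters as unit shifts of [-m-1] and [m+s+1], ready for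
   [pochhammerD1]. *)
have e1 : - m%:R = - m.+1%:R + 1 :> R by rewrite -natr1; ring.
have e2 : m.+1%:R + s + 1 = m%:R + s + 1 + 1 by rewrite -natr1; ring.
have eS k : k.+1%:R = k%:R + 1 :> R by rewrite natr1.
have m1N0 : - m.+1%:R != 0 :> R by rewrite oppr_eq0 pnatr_eq0.
have B0 : m%:R + s + 1 != 0.
  by rewrite -addrA; apply: lt0r_neq0; apply: ltr_wpDl.
have P0 k : pochhammer a k != 0 by apply: lt0r_neq0; apply: pochhammer_gt0.
have F0 k : k`!%:R != 0 :> R by rewrite pnatr_eq0 -lt0n fact_gt0.
have m_ge0 : 0 <= m%:R :> R by [].
rewrite lm1j_b_odd lm1j_u_odd lm1j_b_even lm1j_u_even.
rewrite /even_bracket /odd_bracket /gauss_coef e2 e1.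
(* At [j = 0] multiplication by [x] contributes nothing; a positive even [j] is written [k.+1.*2] so
   that its predecessor is [k.*2.+1]. *)
have [->|[k [->|->]]] : j = 0%N \/ exists k, j = k.*2.+1 \/ j = k.+1.*2.
- case: j => [|j]; [by left|right; exists j./2].
  case: (boolP (odd j)) (odd_double_half j) => _ <- /=.
    by right; rewrite /= ?add1n uphalf_double doubleS.
  by left; rewrite add0n doubleK.
- rewrite /= !pochhammer0 fact0 (eS m).
  generalize (m%:R : R) m_ge0 => M M0.
  split; field; do ?[apply/andP; split]; rewrite //; apply: lt0r_neq0; lra.
- rewrite /= !odd_double /= !doubleK ?uphalf_double /=.
  rewrite !(pochhammerD1 _ m1N0, pochhammerD1 _ B0, pochhammerSr).
  have := P0 k; have := F0 k; have : 0 <= k%:R :> R by [].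
  (* Only three shifted factorials and [k!] remain; as free variables they leave a rational identity
     for [field]. *)
  move: (pochhammer _ _) (pochhammer _ _) (pochhammer _ _) (k`!%:R) => Z W A F.
  rewrite (eS m) in m1N0 *.
  generalize (m%:R : R) m_ge0 (k%:R : R) m1N0 => M M0 K m1N0' K0 Fn0 An0.
  split; field; do ?[apply/andP; split]; rewrite // ?m1N0' //;
    apply: lt0r_neq0; lra.
- rewrite /= !odd_double /= ?uphalf_double !doubleK /=.
  rewrite !(pochhammerD1 _ m1N0, pochhammerD1 _ B0, pochhammerSr) !factS !natrM.
  have := P0 k; have := F0 k; have : 0 <= k%:R :> R by [].
  move: (pochhammer _ _) (pochhammer _ _) (pochhammer _ _) (k`!%:R) => Z W A F.
  rewrite (eS k) (eS m) in m1N0 *.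
  generalize (m%:R : R) m_ge0 (k%:R : R) m1N0 => M M0 K m1N0' K0 Fn0 An0.
  split; field; do ?[apply/andP; split]; rewrite // ?m1N0' //;
    apply: lt0r_neq0; lra.
Qed.

(** * Normalizations and explicit coefficients *)

Lemma even_norm_neq0 m : even_norm m != 0.
Proof.
apply/prodf_neq0 => i _; rewrite oppr_eq0.
have := a_gt0; have := s_gtN1; have : 0 <= i%:R :> R by [].
move: i%:R => I I0 hs ha.
by rewrite lt0r_neq0 // divr_gt0 // mulr_gt0 //; lra.
Qed.

Lemma odd_norm_neq0 m : odd_norm m != 0.
Proof.
rewrite /odd_norm oppr_eq0 !mulf_neq0 ?even_norm_neq0 //.
  by rewrite lt0r_neq0 // ltr_wpDr.
by rewrite invr_neq0 // -addrA lt0r_neq0 // ltr_wpDl // mulr_ge0.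
Qed.

(** The ratio is the factor on the left of the first bracket recurrence. *)
Lemma even_normS m :
  even_norm m.+1 = odd_norm m * ((m%:R + s + 1) / (2 * m%:R + s + 2)).
Proof.
rewrite /odd_norm /even_norm big_ord_recr /=; move: (\prod_(i < m) _) => N.
have := a_gt0; have := s_gtN1; have : 0 <= m%:R :> R by [].
move: m%:R => M M0 hs ha.
by field; do ?[apply/andP; split]; apply: lt0r_neq0; lra.
Qed.

Lemma coef_little_m1_Jacobi m :
  (forall j, (P m.*2)`_j = even_norm m * even_bracket m j) /\
  (forall j, (P m.*2.+1)`_j = odd_norm m * odd_bracket m j).
Proof.
have ha := a_gt0; have hs := s_gtN1.
elim: m => [|m [IHe IHo]].
  rewrite /odd_norm /even_norm !big_ord0 little_m1_Jacobi0 little_m1_Jacobi1.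
  split=> j; rewrite ?coefB ?coefX ?coef1 ?coefC /even_bracket /odd_bracket.
    rewrite mul1r; case: j => [|j]; last first.
      (* For [m = 0] every positive power carries some [(-0)_k] with [k > 0], which vanishes. *)
      case: ifP => jo; rewrite /gauss_coef pochhammerN_eq0 ?mul0r ?oppr0 //.
      by case: j jo.
    by rewrite /= /gauss_coef !pochhammer0 fact0 !mul1r invr1.
  move: halpha hbeta => ? ?; case: j => [|[|j]] /=.
  - rewrite /gauss_coef !pochhammer0 fact0 /lm1j_b /=.
    by field; do ?[apply/andP; split]; apply: lt0r_neq0; lra.
  - rewrite !pochhammerSr !pochhammer0 fact0.
    by field; do ?[apply/andP; split]; apply: lt0r_neq0; lra.
  - by rewrite /gauss_coef pochhammerN_eq0 // !mul0r !oppr0 if_same mulr0 addr0.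
have m_ge0 : 0 <= m%:R :> R by [].
have am0 : a + m%:R != 0 by apply: lt0r_neq0; lra.
(* Degree [2m+2] comes first because degree [2m+3] is computed from it. *)
have IHe' j : (P m.+1.*2)`_j = even_norm m.+1 * even_bracket m.+1 j.
  rewrite (coef_little_m1_JacobiSS m.*2) IHe IHo even_normS -mulrA.
  rewrite (bracket_recurrence m j).1.
  rewrite (_ : (if j is _.+1 then _ else _)
             = odd_norm m * (if j is i.+1 then odd_bracket m i else 0)).
    (* All terms now share the factor [odd_norm m], leaving the bracket recurrence. *)
    have -> : even_norm m = - (odd_norm m * ((2 * m%:R + s + 1) / (a + m%:R))).
      by rewrite /odd_norm; field; do ?[apply/andP; split]; apply: lt0r_neq0; lra.
    by move: (_ / _) => r; case: j => [|j]; ring.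
  by case: j => [|j]; rewrite ?mulr0.
split=> // j; rewrite (coef_little_m1_JacobiSS m.*2.+1) IHe' IHo.
have -> : odd_norm m.+1 = even_norm m.+1 * - ((a + m.+1%:R) / (2 * m%:R + s + 3)).
  rewrite /odd_norm -(natr1 m).
  by field; do ?[apply/andP; split]; apply: lt0r_neq0; lra.
rewrite -[RHS]mulrA (bracket_recurrence m j).2.
rewrite (_ : (if j is _.+1 then _ else _)
           = even_norm m.+1 * (if j is i.+1 then even_bracket m.+1 i else 0)).
  have -> : odd_norm m = even_norm m.+1 * ((2 * m%:R + s + 2) / (m%:R + s + 1)).
    rewrite even_normS.
    by field; do ?[apply/andP; split]; apply: lt0r_neq0; lra.
  by move: (_ / _) => r; case: j => [|j]; ring.
by case: j => [|j]; rewrite ?mulr0 // IHe'.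
Qed.

(** * Back from coefficients to hypergeometric values *)

(** Splitting the first factors off [(-m)_{k+1}] and [(a)_{k+1}] produces the prefactor and raises
    both parameters by one. *)
Lemma even_bracket_odd m k :
  even_bracket m k.*2.+1
  = m%:R / a * gauss_coef (1 - m%:R) (m%:R + s + 1) (a + 1) k.
Proof.
rewrite /even_bracket /gauss_coef /= odd_double uphalf_double /= !pochhammerSl.
rewrite (addrC (- _)) !invfM; ring.
Qed.

(** Here the first factors come off [(m+s+1)_{k+1}] and [(a)_{k+1}]. *)
Lemma odd_bracket_odd m k :
  odd_bracket m k.*2.+1
  = - ((m%:R + s + 1) / a
       * gauss_coef (- m%:R) (m%:R + s + 1 + 1) (a + 1) k).
Proof.
rewrite /odd_bracket /gauss_coef /= odd_double uphalf_double /= !pochhammerSl.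
rewrite !invfM; ring.
Qed.

Lemma even_bracket_even m k :
  even_bracket m k.*2 = gauss_coef (- m%:R) (m%:R + s + 1) a k.
Proof. by rewrite /even_bracket odd_double doubleK. Qed.

Lemma odd_bracket_even m k :
  odd_bracket m k.*2 = gauss_coef (- m%:R) (m%:R + s + 1) a k.
Proof. by rewrite /odd_bracket odd_double doubleK. Qed.

Lemma little_m1_Jacobi_even m x :
  (P m.*2).[x] = even_norm m *
    (hyp2F1 (- m%:R) (m%:R + s + 1) a (x ^+ 2)
     + m%:R / a * x * hyp2F1 (1 - m%:R) (m%:R + s + 1) (a + 1) (x ^+ 2)).
Proof.
have [coefE _] := coef_little_m1_Jacobi m.
rewrite (@horner_even_odd _ _ m.+1); last first.
  by rewrite (leq_trans (size_little_m1_Jacobi _)) // doubleS.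
rewrite mulrDr; congr (_ + _).
  rewrite (hyp2F1_terminating _ _ _ (ltnSn m)) mulr_sumr.
  by apply: eq_bigr => k _; rewrite coefE even_bracket_even -[LHS]mulrA.
have -> : m%:R / a * x * hyp2F1 (1 - m%:R) (m%:R + s + 1) (a + 1) (x ^+ 2)
        = m%:R / a * x * \sum_(k < m.+1)
            gauss_coef (1 - m%:R) (m%:R + s + 1) (a + 1) k * (x ^+ 2) ^+ k.
  (* At [m = 0] this series does not terminate, but its factor [m] is [0]. *)
  case: m {coefE} => [|m]; first by rewrite !mul0r.
  have -> : 1 - m.+1%:R = - m%:R :> R by rewrite -natr1; ring.
  (* This series stops one term earlier than the even one; the extra summand is zero. *)
  by rewrite (@hyp2F1_terminating _ m m.+2).
rewrite !mulr_sumr; apply: eq_bigr => k _.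
rewrite coefE even_bracket_odd; ring.
Qed.

Lemma little_m1_Jacobi_odd m x :
  (P m.*2.+1).[x] = odd_norm m *
    (hyp2F1 (- m%:R) (m%:R + s + 1) a (x ^+ 2)
     - (m%:R + s + 1) / a * x
       * hyp2F1 (- m%:R) (m%:R + s + 1 + 1) (a + 1) (x ^+ 2)).
Proof.
have [_ coefE] := coef_little_m1_Jacobi m.
rewrite (@horner_even_odd _ _ m.+1) ?size_little_m1_Jacobi //.
rewrite !(hyp2F1_terminating _ _ _ (ltnSn m)) mulrDr; congr (_ + _).
  rewrite mulr_sumr; apply: eq_bigr => k _.
  by rewrite coefE odd_bracket_even -[LHS]mulrA.
rewrite !mulr_sumr -sumrN mulr_sumr; apply: eq_bigr => k _.
rewrite coefE odd_bracket_odd; ring.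
Qed.

End LittleMinusOneJacobi.

Theorem mainTheorem3 (R : realType) (alpha beta : R)
    (halpha : -1 < alpha) (hbeta : -1 < beta) (n : nat) :
  exists kappa : R, kappa != 0 /\
    (~~ odd n -> forall x : R,
      (little_m1_Jacobi alpha beta n).[x] =
        kappa *
        (hyp2F1 (- (n%:R / 2)) ((n%:R + alpha + beta + 2) / 2)
                ((alpha + 1) / 2) (x ^+ 2)
         + n%:R * x / (alpha + 1)
           * hyp2F1 (1 - n%:R / 2) ((n%:R + alpha + beta + 2) / 2)
                    ((alpha + 3) / 2) (x ^+ 2))) /\
    (odd n -> forall x : R,
      (little_m1_Jacobi alpha beta n).[x] =
        kappa *
        (hyp2F1 ((1 - n%:R) / 2) ((n%:R + alpha + beta + 1) / 2)
                ((alpha + 1) / 2) (x ^+ 2)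
         - (alpha + beta + n%:R + 1) * x / (alpha + 1)
           * hyp2F1 ((1 - n%:R) / 2) ((n%:R + alpha + beta + 3) / 2)
                    ((alpha + 3) / 2) (x ^+ 2))).
Proof.
have a0 : alpha + 1 != 0 by apply: lt0r_neq0; lra.
(* Both brackets have constant term 1, so this witness is the value of the polynomial at 0. *)
exists (if odd n then odd_norm alpha beta n./2 else even_norm alpha beta n./2).
split; first by case: ifP => _; [exact: odd_norm_neq0|exact: even_norm_neq0].
have nE := odd_double_half n; split=> [no x|no x].
  rewrite -nE (negbTE no) add0n doubleK odd_double.
  rewrite little_m1_Jacobi_even // -mul2n natrM.
  (* With [n = 2M], what remains is to match parameters, the prefactor [M / a] being
     [n / (alpha + 1)]. *)
  move: (n./2)%:R => M.
  have -> : - (2 * M / 2) = - M by field.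
  have -> : (2 * M + alpha + beta + 2) / 2 = M + (alpha + beta) / 2 + 1 by field.
  have -> : (alpha + 3) / 2 = (alpha + 1) / 2 + 1 by field.
  by congr (_ * (_ + _ * _)); field.
rewrite -nE no add1n /= odd_double uphalf_double.
rewrite little_m1_Jacobi_odd // -(natr1 n./2.*2) -mul2n natrM.
move: (n./2)%:R => M.
have -> : (1 - (2 * M + 1)) / 2 = - M by field.
have -> : (2 * M + 1 + alpha + beta + 1) / 2 = M + (alpha + beta) / 2 + 1.
  by field.
have -> : (2 * M + 1 + alpha + beta + 3) / 2 = M + (alpha + beta) / 2 + 1 + 1.
  by field.
have -> : (alpha + 3) / 2 = (alpha + 1) / 2 + 1 by field.
by congr (_ * (_ - _ * _)); field.
Qed.
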